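(* Let $\Pi$ be a bicriteria minimization problem with polynomially computable, nonnegative rational-valued objective functions $f_1,f_2$, and suppose that for each instance $I$ and $i=1,2$ one can compute in polynomial time positive rational numbers $\mathrm{LB}(I,i),\mathrm{UB}(I,i)$ such that $\mathrm{LB}(I,i)\le f_i(I,x)\le\mathrm{UB}(I,i)$ for every feasible solution $x\in S(I)$ with $f_i(I,x)>0$. Given $0<\epsilon\leq 1$ and a polynomial-time $\alpha$-approximation algorithm for the weighted sum problem $\Pi^{\mathrm{WS}}$, it is possible to compute an $\left(\alpha\cdot(1+2\epsilon),\ \alpha\cdot\left(1+\frac{2}{\epsilon}\right)\right)$-approximate Pareto curve in time polynomial in the encoding length of the input and linear in $\frac1\epsilon$.
   Context: Bicriteria minimization problem $\Pi$: each instance $I$ has a set $S(I)$ of feasible solutions, and two objective functions to be minimized are given by polynomial-time algorithms $f_1,f_2$ that, given $I$ and $x\in S(I)$, compute the values $f_1(I,x),f_2(I,x)$ (here: nonnegative rational numbers). Weighted sum problem $\Pi^{\mathrm{WS}}$: given an instance $I$ and a weight $\gamma>0$, find $x\in S(I)$ minimizing $f_1(I,x)+\gamma\cdot f_2(I,x)$ over $S(I)$. Polynomial-time $\alpha$-approximation algorithm ($\alpha\ge 1$) for a minimization problem: an algorithm that, for any given instance, in time polynomial in the encoding length of the instance, finds a feasible solution with objective value at most $\alpha$ times the optimal objective value if a feasible solution exists, and outputs infeasibility otherwise. For $\alpha',\beta'\ge1$, an $(\alpha',\beta')$-approximate Pareto curve for an instance $I$ is a set $P$ of feasible solutions such that for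 every $x\in S(I)$ there exists $x'\in P$ with $f_1(I,x')\le\alpha'\cdot f_1(I,x)$ and $f_2(I,x')\le\beta'\cdot f_2(I,x)$. *)

(* Defs.v *)
From Corelib Require BinNums.
From mathcomp Require Import all_boot all_order all_algebra.
From mathcomp Require Import boolp classical_sets reals.
Set Implicit Arguments.
Unset Strict Implicit.
Unset Printing Implicit Defensive.
Import Order.TTheory GRing.Theory Num.Theory.
Local Open Scope classical_set_scope.
Local Open Scope ring_scope.

(* Model of computation: structured programs acting on stacks of bits, one time
   unit per elementary operation.  A program mentions finitely many stacks.
   A Turing machine tape is a pair of stacks and a stack is a half-tape, so
   these programs and multi-tape Turing machines simulate each other with
   constant-factor overhead. *)

Definition word := seq bool.
Definition store := nat -> word.

Definition upd (s : store) (r : nat) (w : word) : store :=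
  fun q => if q == r then w else s q.

(* [Pop r ce cf ct] removes the top bit of stack [r] and continues with [cf] or
   [ct] according to that bit, or with [ce] if [r] is empty.
   [While r c] repeats [c] as long as stack [r] is nonempty. *)
Inductive prog : Type :=
| Skip
| Push of nat & bool
| Pop of nat & prog & prog & prog
| Seq of prog & prog
| While of nat & prog.

(* [exec c s t s']: started in [s], [c] halts in [s'] after [t] time units. *)
Inductive exec : prog -> store -> nat -> store -> Prop :=
| ExecSkip s : exec Skip s 1 s
| ExecPush r b s : exec (Push r b) s 1 (upd s r (b :: s r))
| ExecPopEmpty r ce cf ct s t s' :
    s r = [::] -> exec ce s t s' -> exec (Pop r ce cf ct) s t.+1 s'
| ExecPop r ce cf ct b w s t s' :
    s r = b :: w -> exec (if b then ct else cf) (upd s r w) t s' ->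
    exec (Pop r ce cf ct) s t.+1 s'
| ExecSeq c1 c2 s1 t1 s2 t2 s3 :
    exec c1 s1 t1 s2 -> exec c2 s2 t2 s3 -> exec (Seq c1 c2) s1 (t1 + t2)%N s3
| ExecWhileStop r c s : s r = [::] -> exec (While r c) s 1 s
| ExecWhileStep r c s1 t1 s2 t2 s3 :
    s1 r <> [::] -> exec c s1 t1 s2 -> exec (While r c) s2 t2 s3 ->
    exec (While r c) s1 (t1 + t2).+1 s3.

(* The input is on stack 0, all other stacks being empty; the output is what
   stack 0 holds on termination, the other stacks being disregarded. *)
Definition init (w : word) : store := upd (fun=> [::]) 0 w.

Definition outputs (c : prog) (input : word) (t : nat) (output : word) : Prop :=
  exists2 s, exec c (init input) t s & s 0%N = output.

(* [c] solves, in time polynomial in the length of its input, the task given by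
   the relation [ok] between (encoded) inputs satisfying [dom] and outputs. *)
Definition solves_in_polytime (A B : Type) (encA : A -> word) (encB : B -> word)
    (dom : A -> Prop) (ok : A -> B -> Prop) (c : prog) : Prop :=
  exists p : {poly nat}, forall a, dom a ->
    exists t b, [/\ outputs c (encA a) t (encB b),
                    (t <= p.[size (encA a)])%N & ok a b].

Definition polytime_computable (A B : Type) (encA : A -> word)
    (encB : B -> word) (dom : A -> Prop) (g : A -> B) : Prop :=
  exists c, solves_in_polytime encA encB dom (fun a b => b = g a) c.

(* Self-delimiting encoding of a finite sequence of words: each bit of a word is
   preceded by [true], and each word is followed by [false]. *)
Definition enc_word (w : word) : word :=
  rcons (flatten [seq [:: true; b] | b <- w]) false.
Definition enc_words (ws : seq word) : word := flatten (map enc_word ws).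

(* Binary digits, least significant first, without leading zeros. *)
Fixpoint enc_pos (n : BinNums.positive) : word :=
  match n with
  | BinNums.xH => [:: true]
  | BinNums.xO n' => false :: enc_pos n'
  | BinNums.xI n' => true :: enc_pos n'
  end.
Definition enc_nat (n : nat) : word :=
  if bin_of_nat n is BinNums.Npos m then enc_pos m else [::].

(* Sign bit, numerator and denominator, in lowest terms. *)
Definition enc_rat (q : rat) : word :=
  enc_words [:: [:: q < 0]; enc_nat `|numq q|%N; enc_nat `|denq q|%N].

Record bicriteria := Bicriteria {
  inst : Type;
  sol : eqType;
  enc_inst : inst -> word;
  enc_inst_inj : injective enc_inst;
  enc_sol : sol -> word;
  enc_sol_inj : injective enc_sol;
  feasible : inst -> set sol;
  obj : 'I_2 -> inst -> sol -> rat
}.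

Section Bicriteria.
Variable Pi : bicriteria.
Implicit Types (I : inst Pi) (x : sol Pi).

Definition enc_inst_sol (Ix : inst Pi * sol Pi) : word :=
  enc_words [:: enc_inst Ix.1; enc_sol Ix.2].

Definition enc_inst_rat (Iq : inst Pi * rat) : word :=
  enc_words [:: enc_inst Iq.1; enc_rat Iq.2].

(* [None], encoded by the empty sequence, reports infeasibility. *)
Definition enc_answer (o : option (sol Pi)) : word :=
  enc_words (if o is Some x then [:: enc_sol x] else [::]).

Definition enc_sols (P : seq (sol Pi)) : word :=
  enc_words [seq enc_sol x | x <- P].

Definition objectives_nonneg : Prop :=
  forall i I x, feasible I x -> 0 <= obj i I x.

Definition objectives_polytime : Prop :=
  forall i, polytime_computable enc_inst_sol enc_rat
    (fun Ix => feasible Ix.1 Ix.2) (fun Ix => obj i Ix.1 Ix.2).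

Definition polytime_bound (B : 'I_2 -> inst Pi -> rat) : Prop :=
  forall i, (forall I, 0 < B i I) /\
    polytime_computable (@enc_inst Pi) enc_rat (fun=> True) (B i).

Definition ws_obj I (gamma : rat) x : rat :=
  obj 0 I x + gamma * obj 1 I x.

Variable R : realType.

(* Feasible sets may be infinite, so the optimal value is an infimum. *)
Definition ws_opt I (gamma : rat) : R :=
  inf [set ratr (ws_obj I gamma x) | x in feasible I].

Definition ws_approx_answer (alpha : R) (Ig : inst Pi * rat)
    (o : option (sol Pi)) : Prop :=
  match o with
  | Some x => feasible Ig.1 x /\
      ratr (ws_obj Ig.1 Ig.2 x) <= alpha * ws_opt Ig.1 Ig.2
  | None => feasible Ig.1 = set0
  end.

Definition polytime_ws_approx (alpha : R) (c : prog) : Prop :=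
  solves_in_polytime enc_inst_rat enc_answer (fun Ig => 0 < Ig.2)
    (ws_approx_answer alpha) c.

Definition approx_pareto_curve (alpha' beta' : R) I (P : set (sol Pi)) : Prop :=
  P `<=` feasible I /\
  forall x, feasible I x -> exists x', [/\ P x',
    ratr (obj 0 I x') <= alpha' * ratr (obj 0 I x) &
    ratr (obj 1 I x') <= beta' * ratr (obj 1 I x)].

End Bicriteria.

(* Main.v *)
(* The answers of the weighted sum algorithm at the weights 2^k and 2^-k, for all
   k below a polynomial N in the input length, already form the curve.  For a
   feasible x with f_1(x), f_2(x) > 0 some such weight g is within a factor 2 of
   eps * f_1(x) / f_2(x), and f_1(x') + g * f_2(x') <= alpha * (f_1(x) + g * f_2(x))
   then gives both approximation factors.  If f_i(x) = 0, an extreme weight forces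
   f_i(x') below LB_i, hence to 0.  The bounds LB_i and UB_i are needed only to
   know that the positive objective values lie in [2^-L, 2^L] with L polynomial in
   the input length: the program computes neither them nor the objectives.
   Neither does it inspect the answers, because the encoding of a list of
   solutions is the concatenation of the encodings of its members. *)

Require Import Defs.
From mathcomp Require Import all_boot all_order all_algebra.
From mathcomp Require Import boolp classical_sets reals.
From mathcomp Require Import zify lra ring.
Set Implicit Arguments.
Unset Strict Implicit.
Unset Printing Implicit Defensive.
Import Order.TTheory GRing.Theory Num.Theory.
Local Open Scope classical_set_scope.
Local Open Scope ring_scope.

(** * Relocating a program to higher stacks *)

Fixpoint shift (m : nat) (c : prog) : prog :=
  match c with
  | Skip => Skip
  | Push r b => Push (m + r) b
  | Pop r ce cf ct => Pop (m + r) (shift m ce) (shift m cf) (shift m ct)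
  | Seq c1 c2 => Seq (shift m c1) (shift m c2)
  | While r c1 => While (m + r) (shift m c1)
  end.

(** Separates the registers of a caller, kept in a list so that updates reduce by computation, from
    the store of a subroutine lying above them. *)
Definition join (l : seq word) (s : store) : store :=
  fun q => if (q < size l)%N then nth [::] l q else s (q - size l)%N.

Definition empty : store := fun=> [::].

Lemma join_lo l s r : (r < size l)%N -> join l s r = nth [::] l r.
Proof. by rewrite /join => ->. Qed.

Lemma join_hi l s r : join l s (size l + r)%N = s r.
Proof. by rewrite /join ltnNge leq_addr /= addKn. Qed.

Lemma upd_join_lo l s r w :
  (r < size l)%N -> upd (join l s) r w = join (set_nth [::] l r w) s.
Proof.
move=> rl; apply/funext => q; rewrite /upd /join size_set_nth.
rewrite (maxn_idPr rl) nth_set_nth /=.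
by case: eqP => [->|//]; rewrite rl.
Qed.

Lemma upd_join_hi l s r w :
  upd (join l s) (size l + r)%N w = join l (upd s r w).
Proof.
apply/funext => q; rewrite /upd /join.
case: eqP => [->|qr]; first by rewrite ltnNge leq_addr /= addKn eqxx.
case: ltnP => // lq; case: eqP => // qr'; case: qr.
by rewrite -qr' subnKC.
Qed.

(** A frame property: every stack index of the shifted program lies beyond [l], so each execution
    rule carries over at the same cost. *)
Lemma exec_shift l c s t s' :
  exec c s t s' -> exec (shift (size l) c) (join l s) t (join l s').
Proof.
elim=> {c s t s'} /=.
- by move=> s; constructor.
- move=> r b s; rewrite -upd_join_hi.
  by rewrite -(join_hi l s r); constructor.
- by move=> r ce cf ct s t s' s0 _ IH; apply: ExecPopEmpty; rewrite ?join_hi.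
- move=> r ce cf ct b w s t s' sw _ IH; apply: (@ExecPop _ _ _ _ b w).
    by rewrite join_hi.
  by rewrite upd_join_hi; case: b sw IH.
- by move=> c1 c2 s1 t1 s2 t2 s3 _ IH1 _ IH2; apply: ExecSeq IH2.
- by move=> r c s s0; apply: ExecWhileStop; rewrite join_hi.
- move=> r c s1 t1 s2 t2 s3 s0 _ IH1 _ IH2.
  by apply: ExecWhileStep IH2; rewrite ?join_hi.
Qed.

(** Only [Push] lengthens a stack, by one bit per time unit. This bounds both the answers of a
    program and the debris it leaves behind. *)
Lemma size_exec c s t s' q : exec c s t s' -> (size (s' q) <= size (s q) + t)%N.
Proof.
elim=> {c s t s'}; try by move=> *; lia.
- by move=> r b s; rewrite /upd; case: eqP => [->|_] /=; lia.
- move=> r ce cf ct b w s t s' sw _ IH; apply: leq_trans IH _.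
  by rewrite /upd; case: eqP => [->|_]; rewrite ?sw /=; lia.
Qed.

Fixpoint stacks_bound (c : prog) : nat :=
  match c with
  | Skip => 0
  | Push r _ => r.+1
  | Pop r ce cf ct =>
      maxn r.+1 (maxn (stacks_bound ce) (maxn (stacks_bound cf) (stacks_bound ct)))
  | Seq c1 c2 => maxn (stacks_bound c1) (stacks_bound c2)
  | While r c1 => maxn r.+1 (stacks_bound c1)
  end.

Lemma exec_untouched c s t s' q :
  exec c s t s' -> (stacks_bound c <= q)%N -> s' q = s q.
Proof.
move=> E; elim: E q => {c s t s'} //=.
- by move=> r b s q rq; rewrite /upd; case: eqP => // qr; move: rq; rewrite qr ltnn.
- by move=> r ce cf ct s t s' _ _ IH q; rewrite !geq_max => /and4P[_ h _ _]; apply: IH.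
- move=> r ce cf ct b w s t s' sw _ IH q; rewrite !geq_max => /and4P[rq _ h1 h2].
  rewrite IH; last by case: b {sw IH}.
  by rewrite /upd; case: eqP => // qr; move: rq; rewrite qr ltnn.
- by move=> c1 c2 s1 t1 s2 t2 s3 _ IH1 _ IH2 q; rewrite geq_max => /andP[h1 h2];
    rewrite IH2 // IH1.
- by move=> r c s1 t1 s2 t2 s3 _ _ IH1 _ IH2 q h; rewrite IH2 // IH1 //;
    move: h; rewrite geq_max => /andP[].
Qed.

(** * Time-bounded runs of loops, clearing and moving *)

Definition runs (c : prog) (s : store) (T : nat) (s' : store) : Prop :=
  exists2 t, exec c s t s' & (t <= T)%N.

Lemma runs_weaken c s T T' s' : (T <= T')%N -> runs c s T s' -> runs c s T' s'.
Proof. by move=> h [t E tT]; exists t => //; apply: leq_trans h. Qed.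

Lemma runs_seq c1 c2 s1 T1 s2 T2 s3 :
  runs c1 s1 T1 s2 -> runs c2 s2 T2 s3 -> runs (Seq c1 c2) s1 (T1 + T2) s3.
Proof.
move=> [t1 E1 h1] [t2 E2 h2]; exists (t1 + t2)%N; first exact: ExecSeq E2.
exact: leq_add.
Qed.

Lemma runs_skip s : runs Skip s 1 s.
Proof. by exists 1%N => //; constructor. Qed.

Lemma runs_push l s r b : (r < size l)%N ->
  runs (Push r b) (join l s) 1 (join (set_nth [::] l r (b :: nth [::] l r)) s).
Proof.
move=> rl; exists 1%N => //; rewrite -upd_join_lo // -(join_lo s rl).
by constructor.
Qed.

Lemma runs_pop l s r ce cf ct b w T s' :
  (r < size l)%N -> nth [::] l r = b :: w ->
  runs (if b then ct else cf) (join (set_nth [::] l r w) s) T s' ->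
  runs (Pop r ce cf ct) (join l s) T.+1 s'.
Proof.
move=> rl lr [t E tT]; exists t.+1 => //.
by apply: (@ExecPop _ _ _ _ b w); rewrite ?join_lo ?upd_join_lo.
Qed.

(* [F u w] is the store when [w] is left on stack [r] and the reversal of [u]
   has been consumed. *)
Lemma runs_while_pop r c0 c1 (F : word -> word -> store) T w0 :
  (forall u w, catrev u w = w0 -> F u w r = w) ->
  (forall u b w, catrev u (b :: w) = w0 ->
     runs (if b then c1 else c0) (upd (F u (b :: w)) r w) T (F (b :: u) w)) ->
  runs (While r (Pop r Skip c0 c1)) (F [::] w0) (size w0 * T.+2 + 1)
       (F (rev w0) [::]).
Proof.
move=> Fr step.
suff H w u : catrev u w = w0 ->
    runs (While r (Pop r Skip c0 c1)) (F u w) (size w * T.+2 + 1)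
         (F (catrev w u) [::]) by exact: H.
elim: w u => [|b w IH] u uw /=.
  by exists 1%N => //; apply: ExecWhileStop; rewrite Fr.
have [t1 E1 h1] := step u b w uw.
have [t2 E2 h2] := IH (b :: u) uw.
(* One unit for the loop test and one for the pop make up the [T.+2]. *)
exists (t1.+1 + t2).+1; last by lia.
apply: ExecWhileStep E2; first by rewrite Fr.
by apply: (@ExecPop _ _ _ _ b w); rewrite ?Fr.
Qed.

Definition clear (r : nat) : prog := While r (Pop r Skip Skip Skip).

Lemma runs_clear r s : runs (clear r) s (size (s r) * 3 + 1) (upd s r [::]).
Proof.
pose F (u w : word) := upd s r w.
have -> : s = F [::] (s r) by apply/funext => q; rewrite /F /upd; case: eqP => [->|].
rewrite {2}/F /upd eqxx.
have -> : (fun q => if q == r then [::] else F [::] (s r) q) = F (rev (s r)) [::].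
  by apply/funext => q; rewrite /F /upd; case: eqP.
apply: runs_while_pop => [u w _|u b w _]; first by rewrite /F /upd eqxx.
have -> : upd (F u (b :: w)) r w = F (b :: u) w.
  by apply/funext => q; rewrite /F /upd; case: eqP.
by case: b; apply: runs_skip.
Qed.

Fixpoint clear_from (m K : nat) : prog :=
  if K is K'.+1 then Seq (clear (m + K')) (clear_from m K') else Skip.

Lemma runs_clear_from l s K B :
  (forall q, (K <= q)%N -> s q = [::]) -> (forall q, size (s q) <= B)%N ->
  runs (clear_from (size l) K) (join l s) (K * (B * 3 + 1) + 1) (join l empty).
Proof.
elim: K s => [|K IH] s s0 sB /=.
  have -> : s = empty by apply/funext => q; rewrite s0.
  by apply: runs_weaken (runs_skip _); lia.
have h := runs_clear (size l + K) (join l s).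
rewrite upd_join_hi join_hi in h.
apply: (runs_weaken _ (runs_seq h (IH _ _ _))).
- by have := sB K; lia.
- move=> q Kq; rewrite /upd; case: eqP => // qK; apply: s0.
  by rewrite ltn_neqAle Kq eq_sym andbT; apply/eqP.
- by move=> q; rewrite /upd; case: eqP => // _; apply: sB.
Qed.

Definition move (r1 r2 : nat) : prog :=
  While r1 (Pop r1 Skip (Push r2 false) (Push r2 true)).

Lemma runs_move l s r1 r2 :
  (r1 < size l)%N -> (r2 < size l)%N -> r1 != r2 ->
  runs (move r1 r2) (join l s) (size (nth [::] l r1) * 3 + 1)
    (join (set_nth [::] (set_nth [::] l r2
             (catrev (nth [::] l r1) (nth [::] l r2))) r1 [::]) s).
Proof.
move=> h1 h2 ne.
pose F (u w : word) := join (set_nth [::] (set_nth [::] l r2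
             (u ++ nth [::] l r2)) r1 w) s.
have sz u : size (set_nth [::] l r2 u) = size l.
  by rewrite size_set_nth (maxn_idPr h2).
have sz1 u w : size (set_nth [::] (set_nth [::] l r2 u) r1 w) = size l.
  by rewrite size_set_nth sz (maxn_idPr h1).
have -> : join l s = F [::] (nth [::] l r1).
  apply/funext => q; rewrite /F /join sz1; case: ifP => // ql.
  rewrite !nth_set_nth /=; case: eqP => [->//|_].
  by rewrite nth_set_nth /=; case: eqP => [->|].
rewrite catrevE; apply: runs_while_pop => [u w _|u b w _].
  by rewrite /F join_lo ?sz1 // nth_set_nth /= eqxx.
set l' := set_nth [::] (set_nth [::] l r2 (u ++ nth [::] l r2)) r1 w.
have szl' : size l' = size l by exact: sz1.
have -> : upd (F u (b :: w)) r1 w = join l' s.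
  rewrite upd_join_lo ?sz1 //; congr join.
  apply: (@eq_from_nth _ [::]) => [|q _]; first by rewrite size_set_nth !sz1 (maxn_idPr h1).
  by rewrite !nth_set_nth /= nth_set_nth /=; case: eqP.
have -> : F (b :: u) w = join (set_nth [::] l' r2 (b :: nth [::] l' r2)) s.
  congr join; apply: (@eq_from_nth _ [::]) => [|q _].
    transitivity (size l); first exact: sz1.
    by rewrite size_set_nth szl' (maxn_idPr h2).
  rewrite /l' !nth_set_nth /= !nth_set_nth /= !nth_set_nth /= eqxx.
  rewrite [r2 == r1]eq_sym (negbTE ne).
  by case: (eqVneq q r1) => [->|_]; rewrite ?(negbTE ne) //; case: eqP.
by case: b; apply: runs_push; rewrite szl'.
Qed.

(** Lets stack 0 of the subroutine be handled as one more register of the caller, for loading its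
    input and reading its output. *)
Lemma join_rcons l s : join (rcons l (s 0%N)) (fun q => s q.+1) = join l s.
Proof.
apply/funext => q; rewrite /join size_rcons nth_rcons ltnS.
case: (ltngtP q (size l)) => [//|lq|->]; last by rewrite subnn.
by congr s; lia.
Qed.

(* Stack 0 holds the input and the output, 1 the reversed encoding of the instance,
   2 the number of exponents still to be tried, 3 the current exponent in unary, 4
   is scratch space, 5 collects the answers reversed, 6 holds products in unary;
   the weighted sum algorithm runs on the stacks from 7 on. *)
Definition regs (a b c d e f g h : word) : store :=
  join [:: a; b; c; d; e; f; g; h] empty.

(** * A power of the input length, computed in unary *)

Definition tally : prog :=
  Seq (While 0 (Pop 0 Skip (Seq (Push 4 false) (Push 6 true))
                           (Seq (Push 4 true) (Push 6 true))))
      (move 4 0).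

(** Reading a stack empties it, so the bits are saved on stack 4, where they lie reversed; moving
    them back restores the order. *)
Lemma runs_tally a b c d f g h :
  runs tally (regs a b c d [::] f g h) (size a * 7 + 2)
       (regs a b c d [::] f (nseq (size a) true ++ g) h).
Proof.
pose F u w := regs w b c d u f (nseq (size u) true ++ g) h.
have h1 : runs (While 0 (Pop 0 Skip (Seq (Push 4 false) (Push 6 true))
    (Seq (Push 4 true) (Push 6 true)))) (F [::] a) (size a * 4 + 1) (F (rev a) [::]).
  apply: (@runs_while_pop _ _ _ _ 2) => // u x w _.
  have -> : upd (F u (x :: w)) 0 w = F u w by rewrite /F /regs upd_join_lo.
  have H y : runs (Seq (Push 4 y) (Push 6 true)) (F u w) 2 (F (y :: u) w).
    exact: (runs_seq (T1 := 1) (T2 := 1) (runs_push _ _ _) (runs_push _ _ _)).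
  by case: x.
apply: (runs_weaken _ (runs_seq h1 _)).
  by apply: (_ : _ + (size a * 3 + 1) <= _)%N; lia.
have := @runs_move [:: [::]; b; c; d; rev a; f; nseq (size a) true ++ g; h]
    empty 4 0 isT isT isT.
by rewrite /= size_rev -/(rev (rev a)) revK /F /regs size_rev.
Qed.

Definition multiply : prog :=
  Seq (While 2 (Pop 2 Skip tally tally)) (move 6 2).

Lemma runs_multiply a b k d f h :
  runs multiply (regs a b (nseq k true) d [::] f [::] h)
       (k * (size a * 10 + 4) + 2)
       (regs a b (nseq (k * size a) true) d [::] f [::] h).
Proof.
pose F (u w : word) := regs a b w d [::] f (nseq (size u * size a) true) h.
have h1 : runs (While 2 (Pop 2 Skip tally tally)) (F [::] (nseq k true))
    (k * (size a * 7 + 2).+2 + 1) (F (rev (nseq k true)) [::]).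
  rewrite -{2}(size_nseq k true); apply: runs_while_pop => // u x w _.
  have -> : upd (F u (x :: w)) 2 w = F u w by rewrite /F /regs upd_join_lo.
  have -> : F (x :: u) w =
      regs a b w d [::] f (nseq (size a) true ++ nseq (size u * size a) true) h.
    by rewrite /F /= cat_nseq /ncons -iterD addnC mulSn addnC.
  by case: x; apply: runs_tally.
apply: (runs_weaken _ (runs_seq h1 _)).
  by apply: (_ : _ + (k * size a * 3 + 1) <= _)%N; lia.
rewrite /F size_rev size_nseq.
have := @runs_move [:: a; b; [::]; d; [::]; f; nseq (k * size a) true; h]
    empty 6 2 isT isT isT.
by rewrite /= size_nseq -/(rev _) rev_nseq.
Qed.

Fixpoint power (D : nat) : prog :=
  if D is D'.+1 then Seq multiply (power D') else Skip.

Lemma runs_power D k a b d f h : (0 < size a)%N ->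
  runs (power D) (regs a b (nseq k true) d [::] f [::] h)
       (D * (k * size a ^ D * (size a * 10 + 4) + 2) + 1)
       (regs a b (nseq (k * size a ^ D) true) d [::] f [::] h).
Proof.
move=> a0; elim: D k => [|D IH] k.
  by rewrite expn0 muln1; apply: runs_weaken (runs_skip _).
rewrite expnS mulnA; apply: runs_weaken (runs_seq (runs_multiply _ _ _ _ _ _) (IH _)).
set m := (size a * 10 + 4)%N; set M := (k * size a * size a ^ D)%N.
(* Since [size a] is at least 1, the counter never exceeds its final value [M], which therefore
   bounds the cost of every round. *)
have : (k <= M)%N by rewrite /M -mulnA leq_pmulr // muln_gt0 a0 expn_gt0 a0.
by move=> kM; have := leq_mul kM (leqnn m); lia.
Qed.

(** * Extracting the instance from the input *)

Definition parse : prog :=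
  Seq (Push 4 true)
    (Seq (While 4 (Pop 0 Skip (Seq (Push 1 false) (Pop 4 Skip Skip Skip))
                   (Seq (Push 1 true) (Pop 0 Skip (Push 1 false) (Push 1 true)))))
         (clear 0)).

(** The bit on stack 4 is a flag, removed when the closing [false] of the first word is met. The
    instance keeps its marker bits, ready to be copied into queries; the rest of the input, which
    encodes the accuracy, is erased. *)
Lemma runs_parse u r b c d f g h :
  runs parse (regs (enc_word u ++ r) b c d [::] f g h)
       (size u * 5 + size r * 3 + 10)
       (regs [::] (catrev (enc_word u) b) c d [::] f g h).
Proof.
rewrite /parse; set L := While 4 _.
have H : runs L (regs (enc_word u ++ r) b c d [:: true] f g h) (size u * 5 + 7)
    (regs r (catrev (enc_word u) b) c d [::] f g h).
  elim: u b => [|x u IH] b.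
    rewrite /enc_word /=; set s := regs _ _ _ _ _ _ _ _.
    have [t2 E2 h2] : runs L (regs r (false :: b) c d [::] f g h) 1
        (regs r (false :: b) c d [::] f g h).
      by exists 1%N => //; apply: ExecWhileStop.
    have [t1 E1 h1] : runs (Pop 0 Skip (Seq (Push 1 false) (Pop 4 Skip Skip Skip))
        (Seq (Push 1 true) (Pop 0 Skip (Push 1 false) (Push 1 true)))) s 4
        (regs r (false :: b) c d [::] f g h).
      apply: (@runs_pop _ _ 0 _ _ _ false r) => //.
      apply: (runs_seq (T1 := 1) (T2 := 2)); first exact: runs_push.
      by apply: (@runs_pop _ _ 4 _ _ _ true [::]) => //; apply: runs_skip.
    by exists (t1 + t2).+1; [exact: ExecWhileStep E2 | lia].
  have [t2 E2 h2] := IH (x :: true :: b).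
  have [t1 E1 h1] : runs (Pop 0 Skip (Seq (Push 1 false) (Pop 4 Skip Skip Skip))
      (Seq (Push 1 true) (Pop 0 Skip (Push 1 false) (Push 1 true))))
      (regs (enc_word (x :: u) ++ r) b c d [:: true] f g h) 4
      (regs (enc_word u ++ r) (x :: true :: b) c d [:: true] f g h).
    apply: (@runs_pop _ _ 0 _ _ _ true (x :: enc_word u ++ r)) => //.
    apply: (runs_seq (T1 := 1) (T2 := 2)); first exact: runs_push.
    apply: (@runs_pop _ _ 0 _ _ _ x (enc_word u ++ r)) => //.
    by case: x {E2 IH}; apply: runs_push.
  by exists (t1 + t2).+1; [exact: ExecWhileStep E2 | rewrite /=; lia].
have hc := runs_clear 0 (regs r (catrev (enc_word u) b) c d [::] f g h).
rewrite {3}/regs upd_join_lo // in hc.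
have hp : runs (Push 4 true) (regs (enc_word u ++ r) b c d [::] f g h) 1
  (regs (enc_word u ++ r) b c d [:: true] f g h) by exact: runs_push.
apply: runs_weaken (runs_seq hp (runs_seq H hc)).
by rewrite /regs join_lo //=; lia.
Qed.

Lemma size_enc_word u : size (enc_word u) = (size u * 2 + 1)%N.
Proof.
rewrite /enc_word size_rcons; elim: u => //= b u; lia.
Qed.

(** * Assembling a query *)

Fixpoint pushes (w : word) : prog :=
  if w is b :: w' then Seq (pushes w') (Push 7 b) else Skip.

Lemma runs_pushes w a b c d e f g h :
  runs (pushes w) (regs a b c d e f g h) (size w + 1)
       (regs a b c d e f g (w ++ h)).
Proof.
elim: w => [|x w IH] /=; first exact: runs_skip.
apply: (runs_weaken _ (runs_seq (T2 := 1) IH _)); first by lia.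
exact: runs_push.
Qed.

Definition push_repeatedly (w : word) : prog :=
  Seq (While 3 (Pop 3 Skip (Seq (pushes w) (Push 4 true))
                           (Seq (pushes w) (Push 4 true))))
      (move 4 3).

Lemma runs_push_repeatedly w a b c k f g h :
  runs (push_repeatedly w) (regs a b c (nseq k true) [::] f g h)
       (k * (size w + 7) + 2)
       (regs a b c (nseq k true) [::] f g (flatten (nseq k w) ++ h)).
Proof.
pose F (u v : word) :=
  regs a b c v (nseq (size u) true) f g (flatten (nseq (size u) w) ++ h).
rewrite /push_repeatedly; set P := Seq (pushes w) _.
have h1 : runs (While 3 (Pop 3 Skip P P)) (F [::] (nseq k true))
    (k * (size w + 2).+2 + 1) (F (rev (nseq k true)) [::]).
  rewrite -{2}(size_nseq k true); apply: runs_while_pop => // u x v _.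
  have -> : upd (F u (x :: v)) 3 v = F u v by rewrite /F /regs upd_join_lo.
  rewrite if_same /F /= -catA.
  apply: (runs_weaken _ (runs_seq (T2 := 1) (runs_pushes _ _ _ _ _ _ _ _ _) _)).
    by lia.
  exact: runs_push.
apply: (runs_weaken _ (runs_seq h1 _)).
  by apply: (_ : _ + (k * 3 + 1) <= _)%N; lia.
rewrite /F size_rev size_nseq.
have := @runs_move [:: a; b; c; [::]; nseq k true; f; g; flatten (nseq k w) ++ h]
    empty 4 3 isT isT isT.
by rewrite /= size_nseq -/(rev _) rev_nseq.
Qed.

Definition copy_inst : prog :=
  Seq (While 1 (Pop 1 Skip (Seq (Push 4 false) (Push 7 false))
                           (Seq (Push 4 true) (Push 7 true))))
      (move 4 1).

Lemma runs_copy_inst a b c d f g h :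
  runs copy_inst (regs a b c d [::] f g h) (size b * 7 + 2)
       (regs a b c d [::] f g (catrev b h)).
Proof.
pose F u w := regs a w c d u f g (u ++ h).
have h1 : runs (While 1 (Pop 1 Skip (Seq (Push 4 false) (Push 7 false))
    (Seq (Push 4 true) (Push 7 true)))) (F [::] b) (size b * 4 + 1) (F (rev b) [::]).
  apply: (@runs_while_pop _ _ _ _ 2) => // u x w _.
  have -> : upd (F u (x :: w)) 1 w = F u w by rewrite /F /regs upd_join_lo.
  have H y : runs (Seq (Push 4 y) (Push 7 y)) (F u w) 2 (F (y :: u) w).
    exact: (runs_seq (T1 := 1) (T2 := 1) (runs_push _ _ _) (runs_push _ _ _)).
  by case: x.
apply: (runs_weaken _ (runs_seq h1 _)).
  by apply: (_ : _ + (size b * 3 + 1) <= _)%N; lia.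
have := @runs_move [:: a; [::]; c; d; rev b; f; g; rev b ++ h] empty 4 1 isT isT isT.
by rewrite /= size_rev -/(rev (rev b)) revK catrevE.
Qed.

(** The encodings of [2^k] and [2^-k] both have this shape with constant [pre], [mid] and [suf], so
    a query is written without any arithmetic on weights. *)
Definition query (pre mid suf : word) (k : nat) : word :=
  pre ++ flatten (nseq k mid) ++ suf.

(** A stack grows at its top, so the query is written from its end to its beginning. *)
Definition build_query (pre mid suf : word) : prog :=
  Seq (pushes suf) (Seq (push_repeatedly mid) (Seq (pushes pre) copy_inst)).

Lemma runs_build_query pre mid suf a b c k f g :
  runs (build_query pre mid suf) (regs a b c (nseq k true) [::] f g [::])
       (size pre + size suf + k * (size mid + 7) + size b * 7 + 6)
       (regs a b c (nseq k true) [::] f g (catrev b (query pre mid suf k))).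
Proof.
have hs := runs_pushes suf a b c (nseq k true) [::] f g [::].
rewrite cats0 in hs.
apply: (runs_weaken _ (runs_seq hs (runs_seq (runs_push_repeatedly _ _ _ _ _ _ _ _)
  (runs_seq (runs_pushes _ _ _ _ _ _ _ _ _) (runs_copy_inst _ _ _ _ _ _ _))))).
by lia.
Qed.

(** * Calling the weighted sum algorithm *)

Definition call (c : prog) : prog :=
  Seq (shift 7 c) (Seq (move 7 5) (clear_from 8 (stacks_bound c))).

Definition call_time (c : prog) (B : nat) : nat :=
  B * 4 + 2 + stacks_bound c * (B * 3 + 1).

(** Stack 7 is stack 0 of the callee. Once it is moved to stack 5, the stacks from 8 on that the
    callee can have touched are cleared, so that the next call starts from an empty store again. No
    stack left by the callee is longer than [B]. *)
Lemma runs_call ws a b c d e f g h t out B :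
  outputs ws h t out -> (size h + t <= B)%N ->
  runs (call ws) (regs a b c d e f g h) (call_time ws B)
       (regs a b c d e (catrev out f) g [::]).
Proof.
move=> [s E so] hB; set l := [:: a; b; c; d; e; f; g].
have -> : regs a b c d e f g h = join l (init h).
  by rewrite -(join_rcons l) /regs; congr join; apply/funext.
have := exec_shift l E; rewrite -(join_rcons l s) so => E1.
set s1 := fun q => s q.+1.
have sB q : (size (s q) <= B)%N.
  apply: leq_trans (size_exec q E) (leq_trans _ hB).
  by rewrite leq_add2r /init /upd; case: eqP.
have h2 := @runs_move (rcons l out) s1 7 5 isT isT isT.
have s0 q : (stacks_bound ws <= q)%N -> s1 q = [::].
  by move=> hq; rewrite /s1 (exec_untouched E) //; apply: leqW.
have h3 := runs_clear_from [:: a; b; c; d; e; catrev out f; g; [::]] s0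
  (fun q => sB q.+1).
have h1 : runs (shift 7 ws) (join l (init h)) t (join (rcons l out) s1) by exists t.
apply: runs_weaken (runs_seq h1 (runs_seq h2 h3)).
by have := sB 0%N; rewrite so /call_time /=; lia.
Qed.

(** * The enumeration of the weights and its running time *)

Definition try_weights (c : prog) (pre1 suf1 pre2 suf2 mid : word) : prog :=
  Seq (Seq (build_query pre1 mid suf1) (call c))
    (Seq (Seq (build_query pre2 mid suf2) (call c)) (Push 3 true)).

Definition enumerate (c : prog) (D : nat) (pre1 suf1 pre2 suf2 mid : word) : prog :=
  let body := try_weights c pre1 suf1 pre2 suf2 mid in
  Seq (Push 2 true) (Seq (power D) (Seq parse
    (Seq (While 2 (Pop 2 Skip body body)) (move 5 0)))).

Definition enumerate_time (c : prog) (D C n B : nat) : nat :=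
  D * (n ^ D * (n * 10 + 4) + 2) + n * 5 + 20
  + n ^ D * ((C + n ^ D * C + n * 7 + call_time c B) * 2 + 3)
  + n ^ D * B * 6.

Lemma runs_enumerate c D pre1 suf1 pre2 suf2 mid u r (out1 out2 : nat -> word) B
    (inp := enc_word u ++ r) (n := size inp)
    (C := (size pre1 + size suf1 + size pre2 + size suf2 + size mid + 13)%N)
    (in1 := fun k => enc_word u ++ query pre1 mid suf1 k)
    (in2 := fun k => enc_word u ++ query pre2 mid suf2 k) :
  (forall k, (k < n ^ D)%N ->
     exists2 t, outputs c (in1 k) t (out1 k) & (size (in1 k) + t <= B)%N) ->
  (forall k, (k < n ^ D)%N ->
     exists2 t, outputs c (in2 k) t (out2 k) & (size (in2 k) + t <= B)%N) ->
  exists2 t, outputs (enumerate c D pre1 suf1 pre2 suf2 mid) inp t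
      (flatten [seq out1 k ++ out2 k | k <- iota 0 (n ^ D)]) &
    (t <= enumerate_time c D C n B)%N.
Proof.
set N := (n ^ D)%N => ans1 ans2.
(* Each answer arrives reversed on top of the earlier ones; the last [move] turns the whole list
   round. *)
pose acc k := rev (flatten [seq out1 i ++ out2 i | i <- iota 0 k]).
(* An answer is no longer than its query plus the running time, hence no longer than [B]; each round
   collects two. *)
have acc_size k : (k <= N)%N -> (size (acc k) <= k * (B * 2))%N.
  rewrite /acc size_rev; elim: k => [//|k IH] kN.
  rewrite -addn1 iotaD map_cat flatten_cat /= cats0 add0n !size_cat.
  have [t1 [s1 E1 e1] h1] := ans1 _ kN; have [t2 [s2 E2 e2] h2] := ans2 _ kN.
  have := size_exec 0 E1; have := size_exec 0 E2; rewrite e1 e2 /init /upd /=.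
  by have := IH (ltnW kN); lia.
pose b := rev (enc_word u).
have b_size : (size b <= n)%N by rewrite size_rev /n /inp size_cat leq_addr.
have n_gt0 : (0 < n)%N by rewrite /n /inp size_cat /enc_word size_rcons.
set body := try_weights c pre1 suf1 pre2 suf2 mid.
(* Loop invariant: the number of counter bits consumed is both the current exponent and the number
   of rounds whose answers are stored. *)
pose F (v w : word) := regs [::] b w (nseq (size v) true) [::] (acc (size v)) [::] [::].
pose Tb := ((C + N * C + n * 7 + call_time c B) * 2)%N.
have loop : runs (While 2 (Pop 2 Skip body body)) (F [::] (nseq N true))
    (N * Tb.+2 + 1) (F (rev (nseq N true)) [::]).
  rewrite -{2}(size_nseq N true); apply: runs_while_pop => // v x w vw.
  have -> : upd (F v (x :: w)) 2 w = F v w by rewrite /F /regs upd_join_lo.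
  rewrite if_same.
  have vN : (size v < N)%N.
    by rewrite -(size_nseq N true) -vw catrevE size_cat size_rev /=; lia.
  rewrite /F [size (x :: v)]/=; move: (size v) vN => k kN.
  have build pre suf f : runs (build_query pre mid suf)
      (regs [::] b w (nseq k true) [::] f [::] [::])
      (size pre + size suf + k * (size mid + 7) + size b * 7 + 6)
      (regs [::] b w (nseq k true) [::] f [::] (enc_word u ++ query pre mid suf k)).
    by have := runs_build_query pre mid suf [::] b w k f [::]; rewrite catrevE revK.
  have [t1 o1 h1] := ans1 k kN; have [t2 o2 h2] := ans2 k kN.
  have -> : acc k.+1 = catrev (out2 k) (catrev (out1 k) (acc k)).
    rewrite /acc -addn1 iotaD map_cat flatten_cat /= cats0 add0n.
    by rewrite !rev_cat !catrevE catA.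
  apply: runs_weaken (runs_seq
    (runs_seq (build _ _ _) (runs_call _ _ _ _ _ _ _ o1 h1))
    (runs_seq (runs_seq (build _ _ _) (runs_call _ _ _ _ _ _ _ o2 h2))
      (runs_push (r := 3) _ _ _))) => //.
  (* The exponent stays below [N], and the summand 13 in [C] absorbs the constants 6 and 7 in the
     cost of building a query. *)
  have := leq_mul (ltnW kN) (leqnn (size mid + 7)).
  have : (N * (size mid + 7) <= N * C)%N by rewrite leq_mul //; lia.
  by rewrite /Tb; lia.
(* The unary 1 is the empty product from which [power] starts. *)
have start : runs (Push 2 true) (init inp) 1
    (regs inp [::] (nseq 1 true) [::] [::] [::] [::] [::]).
  have -> : init inp = regs inp [::] [::] [::] [::] [::] [::] [::].
    by apply/funext; do 8 (case=> //).
  exact: runs_push.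
have pow := runs_power D 1 [::] [::] [::] [::] n_gt0.
have par := runs_parse u r [::] (nseq (1 * n ^ D) true) [::] [::] [::] [::].
rewrite mul1n in pow par.
have fin := @runs_move [:: [::]; b; [::]; nseq N true; [::]; acc N; [::]; [::]]
  empty 5 0 isT isT isT.
rewrite /F size_rev size_nseq in loop.
have [t E tT] := runs_seq start (runs_seq pow (runs_seq par (runs_seq loop fin))).
exists t.
  exists (join [:: rev (acc N); b; [::]; nseq N true; [::]; [::]; [::]; [::]] empty) => //.
  by rewrite /join /= revK.
apply: leq_trans tT _.
have szn : (size u * 2 + 1 + size r = n)%N.
  by rewrite /n /inp size_cat size_enc_word; lia.
have := acc_size N (leqnn N).
rewrite /enumerate_time -/N /Tb [size (nth _ _ _)]/=.
by move: (call_time _ _) (N * C)%N => *; lia.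
Qed.

(** * Polynomial bounds over the natural numbers *)

Lemma leq_horner (p : {poly nat}) m n : (m <= n)%N -> (p.[m] <= p.[n])%N.
Proof.
move=> mn; elim/poly_ind: p => [|p c IH]; first by rewrite !horner0.
by rewrite !hornerMXaddC leq_add2r; apply: leq_mul.
Qed.

(** Replaces a polynomial by a pure power, which [power] can compute. As [n] is at least 2, [n ^ c]
    exceeds the constant [c], and one more factor [n] absorbs a sum of two terms. *)
Lemma horner_leq_exp (p : {poly nat}) :
  exists D, forall n, (1 < n)%N -> (p.[n] <= n ^ D)%N.
Proof.
elim/poly_ind: p => [|p c [D IH]]; first by exists 0%N => n _; rewrite horner0.
exists (maxn D.+1 c).+1 => n n1; rewrite hornerMXaddC.
have n0 : (0 < n)%N by apply: ltnW.
have h1 : (p.[n] * n <= n ^ maxn D.+1 c)%N.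
  apply: (@leq_trans (n ^ D.+1)); last by rewrite leq_pexp2l // leq_maxl.
  by rewrite expnSr leq_mul2r IH ?orbT.
have h2 : (c <= n ^ maxn D.+1 c)%N.
  apply: (@leq_trans (n ^ c)); last by rewrite leq_pexp2l // leq_maxr.
  exact: ltnW (ltn_expl _ _).
rewrite expnS; apply: (@leq_trans (2 * n ^ maxn D.+1 c)%N).
  by rewrite mul2n -addnn; apply: leq_add.
by rewrite leq_mul2r n1 orbT.
Qed.

Definition is_polynomial (f : nat -> nat) : Prop :=
  exists p : {poly nat}, forall n, f n = p.[n].

Lemma polynomial_const k : is_polynomial (fun=> k).
Proof. by exists k%:P => n; rewrite hornerC. Qed.

Lemma polynomial_id : is_polynomial id.
Proof. by exists 'X => n; rewrite hornerX. Qed.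

Lemma polynomial_add f g :
  is_polynomial f -> is_polynomial g -> is_polynomial (fun n => f n + g n)%N.
Proof. by move=> [p pE] [q qE]; exists (p + q) => n; rewrite hornerD pE qE. Qed.

Lemma polynomial_mul f g :
  is_polynomial f -> is_polynomial g -> is_polynomial (fun n => f n * g n)%N.
Proof. by move=> [p pE] [q qE]; exists (p * q) => n; rewrite hornerM pE qE. Qed.

Lemma polynomial_exp f d : is_polynomial f -> is_polynomial (fun n => f n ^ d)%N.
Proof.
move=> fP; elim: d => [|d IH].
  by have [p pE] := polynomial_const 1; exists p => n; rewrite -pE expn0.
have [p pE] := polynomial_mul fP IH.
by exists p => n; rewrite expnS -pE.
Qed.

Lemma polynomial_horner (p : {poly nat}) f :
  is_polynomial f -> is_polynomial (fun n => p.[f n]).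
Proof. by move=> [q qE]; exists (p \Po q) => n; rewrite horner_comp qE. Qed.

Ltac polynomiality := repeat first
  [ exact: polynomial_const | exact: polynomial_id | apply: polynomial_add
  | apply: polynomial_mul | apply: polynomial_exp | apply: polynomial_horner ].

Lemma polynomial_enumerate_time c D C f :
  is_polynomial f -> is_polynomial (fun n => enumerate_time c D C n (f n)).
Proof. by move=> fP; rewrite /enumerate_time /call_time; polynomiality. Qed.

(** * Encodings of rationals and of powers of two *)

Lemma enc_nat_bound n : (n < 2 ^ size (enc_nat n))%N.
Proof.
rewrite /enc_nat -{1}(bin_of_natK n); case: (bin_of_nat n) => [//|p] /=.
elim: p => [p IH|p IH|//] /=; rewrite expnS NatTrec.doubleE /=; lia.
Qed.

Lemma enc_nat_pow2 k : enc_nat (2 ^ k)%N = nseq k false ++ [:: true].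
Proof.
have -> : (2 ^ k)%N = nat_of_bin (BinNums.Npos (iter k BinNums.xO BinNums.xH)).
  elim: k => //= k IH.
  by rewrite expnS IH NatTrec.doubleE mul2n.
by rewrite /enc_nat nat_of_binK; elim: k => //= k ->.
Qed.

(** This is [enc_word] without the closing bit, which makes it a morphism for concatenation. *)
Definition double_bits (w : word) : word := flatten [seq [:: true; b] | b <- w].

Lemma double_bits_cat u v : double_bits (u ++ v) = double_bits u ++ double_bits v.
Proof. by rewrite /double_bits map_cat flatten_cat. Qed.

Lemma double_bits_flatten_nseq k w :
  double_bits (flatten (nseq k w)) = flatten (nseq k (double_bits w)).
Proof. by elim: k => //= k IH; rewrite double_bits_cat IH. Qed.

Lemma enc_wordE w : enc_word w = double_bits w ++ [:: false].
Proof. by rewrite /enc_word -cats1. Qed.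

Lemma double_bits_nseq k b : double_bits (nseq k b) = flatten (nseq k [:: true; b]).
Proof. by elim: k => //= k <-. Qed.

(* The image of the bit [false] under [double_bits] applied twice. *)
Definition exponent_digit : word := [:: true; true; true; false].

(** For [2^k] the prefix is the sign, and the suffix holds the leading one of the numerator and the
    denominator 1. For [2^-k] the prefix also contains the numerator 1. The outer doubling is there
    because a query encodes the encoded weight once more as a word. *)
Definition pow2_pre : word := double_bits [:: true; false; false].
Definition pow2_suf : word := enc_word [:: true; true; false; true; true; false].
Definition pow2V_pre : word := double_bits [:: true; false; false; true; true; false].
Definition pow2V_suf : word := enc_word [:: true; true; false].

Lemma enc_rat_pow2 k :
  enc_rat (2 ^+ k) = [:: true; false; false] ++
    flatten (nseq k [:: true; false]) ++ [:: true; true; false; true; true; false].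
Proof.
have e : 2 ^+ k = ((2 ^ k)%N : int)%:~R :> rat by rewrite -natrX.
rewrite /enc_rat e numq_int denq_int.
have -> : (((2 ^ k)%N : int)%:~R < 0 :> rat) = false by rewrite ltNge ler0z.
rewrite absz_nat enc_nat_pow2 /enc_words /= !enc_wordE double_bits_cat double_bits_nseq.
by rewrite -!catA.
Qed.

Lemma enc_rat_pow2V k :
  enc_rat (2 ^- k) = [:: true; false; false; true; true; false] ++
    flatten (nseq k [:: true; false]) ++ [:: true; true; false].
Proof.
have e : 2 ^- k = (1%:~R / ((2 ^ k)%N : int)%:~R) :> rat by rewrite div1r -natrX.
have cop : coprime `|1%Z| `|((2 ^ k)%N : int)| by rewrite /coprime gcd1n.
have -> : enc_rat (2 ^- k) =
    enc_words [:: [:: false]; enc_nat 1; enc_nat (2 ^ k)].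
  rewrite /enc_rat ltNge invr_ge0 exprn_ge0 // e coprimeq_num // coprimeq_den //.
  have k0 : (0 < 2 ^ k)%N by rewrite expn_gt0.
  by rewrite gtr0_sg // mul1r; case: eqP => [|_]; [lia|].
rewrite enc_nat_pow2 /enc_words /= !enc_wordE double_bits_cat double_bits_nseq.
by rewrite -!catA.
Qed.

Lemma enc_word_rat_pow2 k :
  enc_word (enc_rat (2 ^+ k)) = query pow2_pre exponent_digit pow2_suf k.
Proof.
rewrite enc_rat_pow2 enc_wordE !double_bits_cat double_bits_flatten_nseq.
by rewrite /query -!catA.
Qed.

Lemma enc_word_rat_pow2V k :
  enc_word (enc_rat (2 ^- k)) = query pow2V_pre exponent_digit pow2V_suf k.
Proof.
rewrite enc_rat_pow2V enc_wordE !double_bits_cat double_bits_flatten_nseq.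
by rewrite /query -!catA.
Qed.

Lemma size_query pre mid suf k :
  size (query pre mid suf k) = (size pre + size mid * k + size suf)%N.
Proof. by rewrite /query !size_cat size_flatten /shape map_nseq sumn_nseq addnA. Qed.

(** Numerator and denominator are at least 1 and have at most [L] binary digits each. *)
Lemma pos_rat_bounds (q : rat) L :
  0 < q -> (size (enc_rat q) <= L)%N -> 2 ^- L <= q <= 2 ^+ L.
Proof.
move=> q0; rewrite /enc_rat /enc_words /= !size_cat !size_enc_word /= => hL.
have num0 : 0 < numq q by rewrite numq_gt0.
have den0 := denq_gt0 q.
have pow m : (size (enc_nat m) <= L)%N -> m%:R <= 2 ^+ L :> rat.
  move=> mL; rewrite -natrX ler_nat; apply: (leq_trans (ltnW (enc_nat_bound m))).
  by rewrite leq_exp2l.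
have hn : (numq q)%:~R <= 2 ^+ L :> rat.
  by rewrite -(gtz0_abs num0); apply: pow; lia.
have hd : (denq q)%:~R <= 2 ^+ L :> rat.
  by rewrite -(gtz0_abs den0); apply: pow; lia.
have n1 : 1 <= (numq q)%:~R :> rat by rewrite ler1z; lia.
have d1 : 1 <= (denq q)%:~R :> rat by rewrite ler1z; lia.
have d0 : 0 < (denq q)%:~R :> rat by apply: lt_le_trans d1.
rewrite -(divq_num_den q); apply/andP; split.
  rewrite ler_pdivlMr //; apply: le_trans n1.
  by rewrite mulrC ler_pdivrMr ?mul1r ?exprn_gt0.
rewrite ler_pdivrMr //; apply: (le_trans hn).
by rewrite ler_peMr // exprn_ge0.
Qed.

(** * Choosing the weight for a given solution *)

Definition dyadic {F : fieldType} (s : bool) (k : nat) : F :=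
  if s then 2 ^+ k else 2 ^- k.

Lemma dyadic_gt0 (F : realFieldType) s k : 0 < dyadic s k :> F.
Proof. by case: s; rewrite /dyadic ?invr_gt0 exprn_gt0. Qed.

(** The least power of two that is at least [t] is below [2 * t], because the power before it is
    smaller than [t]. *)
Lemma pow2_between (F : realFieldType) (t : F) M :
  1 <= t -> t <= 2 ^+ M -> exists2 k, (k <= M)%N & t <= 2 ^+ k <= 2 * t.
Proof.
move=> t1; elim: M => [|M IH] tM; first by exists 0%N; rewrite ?tM //=; lra.
have [/IH [k kM h]|lt_t] := lerP t (2 ^+ M); first by exists k => //; apply: leqW.
exists M.+1 => //; rewrite tM exprS /=; lra.
Qed.

(** Below 1 the reciprocal of [t] is rounded instead. *)
Lemma dyadic_near (F : realFieldType) (t : F) M :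
  2 ^- M <= t <= 2 ^+ M ->
  exists k s, [/\ (k <= M)%N, dyadic s k <= 2 * t & t <= 2 * dyadic s k].
Proof.
move=> /andP[lo hi]; have [t1|t1] := lerP 1 t.
  have [k kM /andP[h1 h2]] := pow2_between t1 hi.
  by exists k, true; split => //; rewrite /dyadic; lra.
have t0 : 0 < t by apply: lt_le_trans lo; rewrite invr_gt0 exprn_gt0.
have [||k kM] := @pow2_between F t^-1 M.
- by rewrite invf_ge1 // ltW.
- by rewrite invf_ple ?posrE ?exprn_gt0.
have p0 : 0 < 2 ^+ k :> F by rewrite exprn_gt0.
rewrite -{1}[t^-1]mul1r ler_pdivrMr // ler_pdivlMr // => /andP[h1 h2].
exists k, false; split => //; rewrite /dyadic.
  by rewrite -[_^-1]mul1r ler_pdivrMr //; lra.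
by rewrite ler_pdivlMr //; lra.
Qed.

(** Both [a'] and [g * b'] are at most the weighted sum. The upper bound on [g] gives
    [g * b <= 2 * e * a], so [a] controls the sum; the lower bound gives [a <= 2 * g * b / e], so
    [g * b] controls it. *)
Lemma weighted_sum_tradeoff (F : realFieldType) (al e g a b a' b' : F) :
  1 <= al -> 0 < e -> 0 < a -> 0 < b -> 0 <= a' -> 0 <= b' ->
  0 < g -> g <= 2 * (e * a / b) -> e * a / b <= 2 * g ->
  a' + g * b' <= al * (a + g * b) ->
  a' <= al * (1 + 2 * e) * a /\ b' <= al * (1 + 2 / e) * b.
Proof.
move=> al1 e0 a0 b0 a'0 b'0 g0.
rewrite [_ * (_ / b)]mulrA ler_pdivlMr // ler_pdivrMr // => h1 h2 h.
have gb' : 0 <= g * b' by rewrite mulr_ge0 // ltW.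
have al0 : 0 < al by lra.
split.
  apply: (@le_trans _ _ (al * (a + g * b))); first by lra.
  by rewrite -mulrA ler_pM2l //; lra.
rewrite -(ler_pM2l g0); apply: (@le_trans _ _ (al * (a + g * b))); first by lra.
have -> : g * (al * (1 + 2 / e) * b) = al * (g * b * (1 + 2 / e)) by ring.
rewrite ler_pM2l //.
have : a <= 2 * g * b / e by rewrite ler_pdivlMr //; lra.
by rewrite mulrDr mulr1 -!mulrA; lra.
Qed.

(* When one objective vanishes at the given solution, a weight that is small
   (large) enough pushes the value of that objective below its least positive
   value, hence to zero. *)
Lemma dyadic_weight_exists (F : realFieldType) (al e a b : F) A L :
  1 <= al <= 2 ^+ A -> 2 ^- L <= e <= 1 -> 0 <= a -> 0 <= b ->
  (0 < a -> 2 ^- L <= a <= 2 ^+ L) -> (0 < b -> 2 ^- L <= b <= 2 ^+ L) ->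
  exists k s, (k <= 3 * L + A + 1)%N /\
    forall a' b', 0 <= a' -> 0 <= b' ->
      (0 < a' -> 2 ^- L <= a') -> (0 < b' -> 2 ^- L <= b') ->
      a' + dyadic s k * b' <= al * (a + dyadic s k * b) ->
      a' <= al * (1 + 2 * e) * a /\ b' <= al * (1 + 2 / e) * b.
Proof.
move=> /andP[al1 alA] /andP[eL e1] a0 b0 aL bL.
have L0 : 0 < 2 ^+ L :> F by rewrite exprn_gt0.
have LV0 : 0 < 2 ^- L :> F by rewrite invr_gt0.
have e0 : 0 < e by apply: lt_le_trans eL.
have al0 : 0 < al by lra.
have ei0 : 0 < e^-1 by rewrite invr_gt0.
have scale x y : 0 <= x -> 0 <= y -> x <= al * (1 + 2 * y) * x.
  move=> x0 y0; rewrite -[leLHS]mul1r ler_wpM2r // -[leLHS]mul1r.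
  by apply: ler_pM => //; lra.
(* For [x] at most [2^L], the product [al * x] is at most [2^(A + L)], which is below
   [2^k * 2^-L = 2^(2 * L + A + 1)]. *)
have [k kE] : exists k, k = (L + (2 * L + A + 1))%N by eexists.
have kle : (k <= 3 * L + A + 1)%N by rewrite kE; clear; lia.
have small x : 0 <= x -> x <= 2 ^+ L -> 2 ^- k * (al * x) < 2 ^- L.
  move=> x0 xL; rewrite mulrC ltr_pdivrMr ?exprn_gt0 //.
  have -> : 2 ^- L * 2 ^+ k = 2 ^+ (2 * L + A + 1) :> F.
    by rewrite kE exprD mulKf // gt_eqF.
  apply: (@le_lt_trans _ _ (2 ^+ A * 2 ^+ L)); first by apply: ler_pM => //; lra.
  by rewrite -exprD ltr_eXn2l // ?ltr1n //; clear; lia.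
have [a_gt0|a_le0] := ltP 0 a; last first.
  have -> : a = 0 by apply/le_anti; rewrite a_le0 a0.
  exists k, false; split=> // a' b' a'0 b'0 a'L b'L; rewrite /dyadic add0r !mulr0 => h.
  have g0 : 0 < 2 ^- k :> F by rewrite invr_gt0 exprn_gt0.
  have gb' : 0 <= 2 ^- k * b' by rewrite mulr_ge0 // ltW.
  have bU : b <= 2 ^+ L by have [/bL/andP[_ ->]//|b_le0] := ltP 0 b; lra.
  have h' : a' + 2 ^- k * b' <= 2 ^- k * (al * b) by rewrite mulrCA.
  have bb := small b b0 bU.
  split; first by have [/a'L|] := ltP 0 a'; lra.
  apply: (@le_trans _ _ (al * b)); first by rewrite -(ler_pM2l g0); lra.
  rewrite -mulrA ler_pM2l // -[leLHS]mul1r ler_wpM2r //; lra.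
have [b_gt0|b_le0] := ltP 0 b; last first.
  have -> : b = 0 by apply/le_anti; rewrite b_le0 b0.
  exists k, true; split=> // a' b' a'0 b'0 a'L b'L; rewrite /dyadic !mulr0 addr0 => h.
  have g0 : 0 < 2 ^+ k :> F by rewrite exprn_gt0.
  have gb' : 0 <= 2 ^+ k * b' by rewrite mulr_ge0 // ltW.
  have [_ aU] := andP (aL a_gt0).
  split.
    apply: (@le_trans _ _ (al * a)); first by lra.
    rewrite -mulrA ler_pM2l // -[leLHS]mul1r ler_wpM2r //; lra.
  (* A positive [b'] would be at least [2^-L], making [2^k * b'] exceed [al * a]. *)
  have [/b'L b'_ge|//] := ltP 0 b'.
  have := small a a0 aU; rewrite mulrC ltr_pdivrMr // => aa.
  have : 2 ^- L * 2 ^+ k <= b' * 2 ^+ k by rewrite ler_pM2r.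
  lra.
have [aL1 aL2] := andP (aL a_gt0); have [bL1 bL2] := andP (bL b_gt0).
(* The ratio is at least [2^-(3 * L)], as [e], [a] and the inverse of [b] are each at least [2^-L];
   it is at most [2^(2 * L)], as [e] is at most 1. *)
have [|j [s [jL h1 h2]]] := @dyadic_near F (e * a / b) (3 * L).
  apply/andP; split.
    rewrite ler_pdivlMr //.
    apply: (@le_trans _ _ (2 ^- (3 * L) * 2 ^+ L)).
      by rewrite ler_pM2l // invr_gt0 exprn_gt0.
    have -> : 2 ^- (3 * L) * 2 ^+ L = 2 ^- L * 2 ^- L :> F.
      by rewrite -invfM -!exprD (_ : 3 * L = L + L + L)%N ?exprD ?invfM ?mulfVK ?gt_eqF //; clear; lia.
    by apply: ler_pM => //; apply: ltW.
  rewrite ler_pdivrMr //; apply: (@le_trans _ _ (2 ^+ L)).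
    by rewrite -[leRHS]mul1r; apply: ler_pM => //; apply: ltW.
  apply: (@le_trans _ _ (2 ^+ (3 * L) * 2 ^- L)); last first.
    by rewrite ler_pM2l // exprn_gt0.
  rewrite ler_pdivlMr // -exprD ler_eXn2l ?ltr1n //; clear; lia.
exists j, s; split; first by clear -jL; lia.
move=> a' b' a'0 b'0 _ _; apply: weighted_sum_tradeoff => //.
exact: dyadic_gt0.
Qed.

(** * From the answers to an approximate Pareto curve *)

Definition answer_sols (Pi : bicriteria) (o : option (sol Pi)) : seq (sol Pi) :=
  if o is Some x then [:: x] else [::].

Lemma enc_sols_flatten (Pi : bicriteria) (Ps : seq (seq (sol Pi))) :
  enc_sols (flatten Ps) = flatten (map (@enc_sols Pi) Ps).
Proof.
elim: Ps => //= P Ps <-.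
by rewrite /enc_sols /enc_words !map_cat flatten_cat.
Qed.

Lemma enc_sols_cat (Pi : bicriteria) (P Q : seq (sol Pi)) :
  enc_sols (P ++ Q) = enc_sols P ++ enc_sols Q.
Proof. by rewrite /enc_sols /enc_words !map_cat flatten_cat. Qed.

Lemma enc_sols_answer (Pi : bicriteria) (o : option (sol Pi)) :
  enc_sols (answer_sols o) = enc_answer o.
Proof. by case: o. Qed.

Lemma ratr_obj_ge0 (R : realType) (Pi : bicriteria) i I x :
  objectives_nonneg Pi -> feasible I x -> 0 <= ratr (@obj Pi i I x) :> R.
Proof. by move=> f_nonneg /(f_nonneg i) h; rewrite ler0q. Qed.

(** The infimum is a lower bound only of a set bounded below; nonnegative objectives provide the
    bound 0. *)
Lemma ws_opt_le (R : realType) (Pi : bicriteria) I gamma x :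
  objectives_nonneg Pi -> 0 < gamma -> feasible I x -> ws_opt R I gamma <= ratr (@ws_obj Pi I gamma x).
Proof.
move=> f_nonneg g0 Ix; apply: ge_inf; last by exists x.
exists 0 => _ [y Iy <-]; rewrite ler0q addr_ge0 ?f_nonneg //.
by rewrite mulr_ge0 ?f_nonneg // ltW.
Qed.

(** The weight is chosen over [R], where [alpha] lives, and carried back to the rational weight of a
    query, since [ratr] preserves dyadic numbers and order. *)
Lemma approx_pareto_curve_dyadic (R : realType) (Pi : bicriteria) I (alpha : R)
    eps A L N (ans : rat -> option (sol Pi)) :
  objectives_nonneg Pi ->
  1 <= alpha <= 2 ^+ A -> 2 ^- L <= eps <= 1 ->
  (forall i x, feasible I x -> 0 < obj i I x -> 2 ^- L <= obj i I x <= 2 ^+ L) ->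
  (forall gamma, 0 < gamma -> ws_approx_answer alpha (I, gamma) (ans gamma)) ->
  (3 * L + A + 1 < N)%N ->
  approx_pareto_curve (alpha * (1 + 2 * ratr eps)) (alpha * (1 + 2 / ratr eps)) I
    [set` flatten [seq answer_sols (ans (dyadic true k)) ++
                       answer_sols (ans (dyadic false k)) | k <- iota 0 N]].
Proof.
move=> f_nonneg alA epsL fL ansP LN.
set P := flatten _.
have ratr_pow k : ratr (2 ^+ k) = 2 ^+ k :> R by rewrite rmorphXn /= ratr_nat.
have ratr_powV k : ratr (2 ^- k) = 2 ^- k :> R by rewrite fmorphV /= ratr_pow.
have ratr_dyadic s k : ratr (dyadic s k) = dyadic s k :> R.
  by case: s; [apply: ratr_pow|apply: ratr_powV].
have memP s k x : (k < N)%N -> ans (dyadic s k) = Some x -> x \in P.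
  move=> kN e; apply/flatten_mapP; exists k; first by rewrite mem_iota.
  by rewrite mem_cat; case: s e => ->; rewrite inE eqxx ?orbT.
split=> [x /= /flatten_mapP[k _]|x Ix].
  rewrite mem_cat => /orP[].
    have := ansP _ (dyadic_gt0 rat true k).
    by case: (ans _) => //= y [Iy _]; rewrite inE => /eqP ->.
  have := ansP _ (dyadic_gt0 rat false k).
  by case: (ans _) => //= y [Iy _]; rewrite inE => /eqP ->.
pose v i y : R := ratr (obj i I y).
have bnd i y : feasible I y -> 0 < v i y -> 2 ^- L <= v i y <= 2 ^+ L.
  move=> Iy; rewrite /v ltr0q => /(fL _ _ Iy).
  by rewrite -(ratr_powV L) -(ratr_pow L) !ler_rat.
have epsLR : 2 ^- L <= (ratr eps : R) <= 1.
  have [eps_lo eps_hi] := andP epsL.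
  by rewrite -(ratr_powV L) ler_rat eps_lo -[leRHS](rmorph1 (@ratr R)) ler_rat.
have [k [s [kL H]]] := dyadic_weight_exists alA epsLR (ratr_obj_ge0 _ 0 f_nonneg Ix)
  (ratr_obj_ge0 _ 1 f_nonneg Ix) (bnd _ _ Ix) (bnd _ _ Ix).
have g0 := dyadic_gt0 rat s k.
have := ansP _ g0; have mem := memP s k _ (leq_ltn_trans kL LN).
(* The answer [None] would make the feasible set empty, against [x]. *)
case: (ans _) mem => [y mem [/= Iy wy]|_ /= e]; last by move: Ix; rewrite e.
have lo i : 0 < v i y -> 2 ^- L <= v i y.
  by move=> /(bnd _ _ Iy) /andP[].
have [|h1 h2] := H _ _ (ratr_obj_ge0 _ 0 f_nonneg Iy) (ratr_obj_ge0 _ 1 f_nonneg Iy) (lo _) (lo _).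
  rewrite -(ratr_dyadic s) -!rmorphM -!rmorphD; apply: (le_trans wy).
  rewrite ler_wpM2l ?(ws_opt_le _ f_nonneg) //; have /andP[a1 _] := alA.
  exact: le_trans a1.
by exists y; split => //; apply: mem.
Qed.

Theorem mainTheorem7 (R : realType) (Pi : bicriteria)
    (f_nonneg : objectives_nonneg Pi)
    (f_polytime : objectives_polytime Pi)
    (LB UB : 'I_2 -> inst Pi -> rat)
    (LB_polytime : polytime_bound LB)
    (UB_polytime : polytime_bound UB)
    (f_bounds : forall (i : 'I_2) (I : inst Pi) (x : sol Pi),
       feasible I x -> 0 < obj i I x -> LB i I <= obj i I x <= UB i I)
    (alpha : R) (alpha_ge1 : 1 <= alpha)
    (ws_alg : prog) (ws_algP : polytime_ws_approx Pi alpha ws_alg) :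
  exists (c : prog) (p : {poly nat}),
    forall (I : inst Pi) (eps : rat), 0 < eps -> eps <= 1 ->
      exists (t : nat) (P : seq (sol Pi)),
        [/\ outputs c (enc_inst_rat (I, eps)) t (enc_sols P),
            t%:R <= p.[size (enc_inst_rat (I, eps))]%:R * (1 / eps) &
            approx_pareto_curve (alpha * (1 + 2 * ratr eps))
              (alpha * (1 + 2 / ratr eps)) I [set` P]].
Proof.
(* A program writes at most one bit per time unit, so a value computable in polynomial time has an
   encoding of polynomial length. *)
have bound_size (B : 'I_2 -> inst Pi -> rat) : polytime_bound B ->
    exists q : {poly nat}, forall i I, 0 < B i I /\
      (size (enc_rat (B i I)) <= q.[size (enc_inst I)])%N.
  move=> BP.
  have Bi i : exists q : {poly nat}, forall I,
      (size (enc_rat (B i I)) <= q.[size (enc_inst I)])%N.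
    have [_ [c [q qP]]] := BP i; exists ('X + q) => I.
    have [t [b [[s E e] tq be]]] := qP I Logic.I.
    by rewrite hornerD hornerX -be -e; apply: leq_trans (size_exec 0 E) (leq_add _ tq).
  have [q0 h0] := Bi 0; have [q1 h1] := Bi 1.
  exists (q0 + q1) => i I; split; first by have [] := BP i.
  rewrite hornerD; case: i => -[|[|//]] lti.
    by rewrite (_ : Ordinal lti = 0); [apply: leq_trans (h0 I) (leq_addr _ _)|apply/val_inj].
  by rewrite (_ : Ordinal lti = 1); [apply: leq_trans (h1 I) (leq_addl _ _)|apply/val_inj].
have [qL LBP] := bound_size _ LB_polytime.
have [qU UBP] := bound_size _ UB_polytime.
have [q ws_q] := ws_algP.
pose A := Num.bound alpha.
have alA : 1 <= alpha <= 2 ^+ A.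
  by rewrite alpha_ge1 ltW // upper_nthrootP.
(* The three summands bound the encoding lengths of [eps], of the lower bounds and of the upper
   bounds. *)
pose Lp : {poly nat} := 'X + qL + qU.
(* The 2 instead of 1 makes the largest exponent [3 * L + A + 1] strictly smaller than the number of
   exponents tried. *)
pose Np : {poly nat} := 3%N%:P * Lp + (A + 2)%N%:P.
have [D DP] := horner_leq_exp Np.
pose C := (size pow2_pre + size pow2_suf + size pow2V_pre + size pow2V_suf
           + size exponent_digit + 13)%N.
(* Bounds the length of a query: [n] for the instance, four bits for each of fewer than [n ^ D]
   exponent digits, and at most 40 for the constant ends. *)
pose M n := (n + 4 * n ^ D + 40)%N.
have [p pE] : is_polynomial (fun n => enumerate_time ws_alg D C n (M n + q.[M n])).
  by apply: polynomial_enumerate_time; rewrite /M; polynomiality.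
exists (enumerate ws_alg D pow2_pre pow2_suf pow2V_pre pow2V_suf exponent_digit), p.
move=> I eps eps0 eps1.
have encE gamma : enc_inst_rat (I, gamma) =
    enc_word (enc_inst I) ++ enc_word (enc_rat gamma).
  by rewrite /enc_inst_rat /enc_words /= cats0.
(* Fixes one answer per weight; [None] at weights that are not positive is a mere default. *)
have /choice[ans ansP] gamma : exists o, 0 < gamma ->
    (exists2 t, outputs ws_alg (enc_inst_rat (I, gamma)) t (enc_answer o) &
       (t <= q.[size (enc_inst_rat (I, gamma))])%N) /\
    ws_approx_answer alpha (I, gamma) o.
  have [g0|] := ltP 0 gamma; last by exists None.
  by have [t [o [h1 h2 h3]]] := ws_q (I, gamma) g0; exists o => _; split => //; exists t.
set n := size (enc_inst_rat (I, eps)).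
have n2 : (1 < n)%N by rewrite /n encE size_cat !size_enc_word; lia.
have instn : (size (enc_inst I) <= n)%N by rewrite /n encE size_cat size_enc_word; lia.
have run s k : (k < n ^ D)%N -> exists2 t,
    outputs ws_alg (enc_inst_rat (I, dyadic s k)) t (enc_answer (ans (dyadic s k))) &
    (size (enc_inst_rat (I, dyadic s k)) + t <= M n + q.[M n])%N.
  move=> kN; have [[t o tq] _] := ansP _ (dyadic_gt0 rat s k); exists t => //.
  have sM : (size (enc_inst_rat (I, dyadic s k)) <= M n)%N.
    have : (size (enc_word (enc_inst I)) <= n)%N by rewrite /n encE size_cat leq_addr.
    rewrite encE size_cat /M /dyadic; case: s {o tq}.
      by rewrite enc_word_rat_pow2 size_query /=; lia.
    by rewrite enc_word_rat_pow2V size_query /=; lia.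
  by apply: leq_add => //; apply: leq_trans tq (leq_horner _ sM).
have [||t out tT] := @runs_enumerate ws_alg D pow2_pre pow2_suf pow2V_pre pow2V_suf
  exponent_digit (enc_inst I) (enc_word (enc_rat eps))
  (fun k => enc_answer (ans (dyadic true k)))
  (fun k => enc_answer (ans (dyadic false k))) (M n + q.[M n]).
- rewrite -encE -/n => k /(run true)[t].
  by rewrite encE /dyadic enc_word_rat_pow2 => h1 h2; exists t.
- rewrite -encE -/n => k /(run false)[t].
  by rewrite encE /dyadic enc_word_rat_pow2V => h1 h2; exists t.
rewrite -encE -/n -/C in out tT.
exists t, (flatten [seq answer_sols (ans (dyadic true k)) ++
                        answer_sols (ans (dyadic false k)) | k <- iota 0 (n ^ D)]).
split.
- rewrite enc_sols_flatten -map_comp; congr (outputs _ _ _ (flatten _)): out.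
  by apply: eq_map => k /=; rewrite enc_sols_cat !enc_sols_answer.
- have tp : (t <= p.[n])%N by rewrite -pE.
  (* The running time is polynomial in the input length alone, and [1 / eps] is at least 1. *)
  apply: (@le_trans _ _ p.[n]%:R); first by rewrite ler_nat.
  by rewrite ler_peMr // div1r invf_ge1.
apply: (approx_pareto_curve_dyadic (L := Lp.[n]) f_nonneg alA).
- have sz_eps : (size (enc_rat eps) <= Lp.[n])%N.
    by rewrite /Lp !hornerD hornerX /n encE size_cat !size_enc_word; lia.
  by have /andP[-> _] := pos_rat_bounds eps0 sz_eps.
- move=> i x Ix fx; have /andP[l_f f_u] := f_bounds i I x Ix fx.
  have [LB0 LBs] := LBP i I; have [UB0 UBs] := UBP i I.
  have szL : (size (enc_rat (LB i I)) <= Lp.[n])%N.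
    by rewrite !hornerD; have := leq_horner qL instn; lia.
  have szU : (size (enc_rat (UB i I)) <= Lp.[n])%N.
    by rewrite !hornerD; have := leq_horner qU instn; lia.
  have /andP[lb _] := pos_rat_bounds LB0 szL.
  have /andP[_ ub] := pos_rat_bounds UB0 szU.
  by rewrite (le_trans lb l_f) (le_trans f_u ub).
- by move=> gamma /ansP[].
- have : (3 * Lp.[n] + (A + 2) <= n ^ D)%N.
    by have := DP n n2; rewrite /Np hornerD hornerM !hornerC.
  by move: Lp.[n] => l; clear; lia.
Qed.
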